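(* The $\infty$-Degree Conjecture is equivalent to the $\infty$-JC (the generalized Jacobian Conjecture over $\mathbb{C}$); that is, one is true if and only if the other is true.
   Context: For a $\mathbb{C}$-algebra endomorphism $F:\mathbb{C}[x_1,\ldots,x_n]\to\mathbb{C}[x_1,\ldots,x_n]$ write $F_i=F(x_i)$, $1\le i\le n$. We say $F$ has an invertible Jacobian if $\operatorname{Jac}(F_1,\ldots,F_n)=\det(\partial F_i/\partial x_j)\in\mathbb{C}^*$. Degrees of polynomials are total degrees. The $n$-JC is the statement: every $\mathbb{C}$-algebra endomorphism $F$ of $\mathbb{C}[x_1,\ldots,x_n]$ with an invertible Jacobian is an automorphism. The $\infty$-JC is the statement: the $n$-JC is true for all $n\ge 1$. The $n$-Degree Conjecture is the statement: for every $\mathbb{C}$-algebra endomorphism $F$ of $\mathbb{C}[x_1,\ldots,x_n]$ with an invertible Jacobian, if $d$ is the minimum of the degrees of $F_1,\ldots,F_n$, then the degree of the field extension $\mathbb{C}(F_1,\ldots,F_n)\subseteq\mathbb{C}(x_1,\ldots,x_n)$ is less than or equal to $d^{n-1}$. The $\infty$-Degree Conjecture is the statement: the $n$-Degree Conjecture is true for all $n\ge 2$. *)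

(* Defs.v *)
From HB Require Import structures.
From mathcomp Require Import all_boot all_order all_algebra.
From mathcomp Require Import mpoly complex.
From mathcomp Require Import boolp classical_sets reals.

Set Implicit Arguments.
Unset Strict Implicit.
Unset Printing Implicit Defensive.

Import GRing.Theory.
Local Open Scope classical_set_scope.
Local Open Scope ring_scope.

Section FieldDegree.
Variable L : fieldType.

Definition lin_indep (K : set L) (m : nat) (b : 'I_m -> L) : Prop :=
  forall a : 'I_m -> L, (forall i, K (a i)) ->
    \sum_(i < m) a i * b i = 0 -> forall i, a i = 0.

Definition lin_span (K : set L) (m : nat) (b : 'I_m -> L) : Prop :=
  forall z : L, exists a : 'I_m -> L,
    (forall i, K (a i)) /\ z = \sum_(i < m) a i * b i.

(* [L : K] = m, for K a subfield of L; in particular L is finite over K. *)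
Definition ext_degree (K : set L) (m : nat) : Prop :=
  exists b : 'I_m -> L, lin_indep K b /\ lin_span K b.

(* Since L is a field, the divring_closed subsets of L are its subfields. *)
Definition generated_subfield (G : set L) : set L :=
  smallest [set S : set L | GRing.divring_closed [pred x in S]] G.

End FieldDegree.

Section Endomorphisms.
Variables (k : fieldType) (n : nat).
Implicit Type F : {lrmorphism {mpoly k[n]} -> {mpoly k[n]}}.

Definition jacobian_matrix F : 'M[{mpoly k[n]}]_n :=
  \matrix_(i < n, j < n) (F 'X_i)^`M(j).

Definition invertible_jacobian F : Prop :=
  exists c : k, c != 0 /\ \det (jacobian_matrix F) = c%:MP.

(* msize is one more than the total degree on nonzero polynomials. *)
Definition tdeg (p : {mpoly k[n]}) : nat := (msize p).-1.

Definition is_min_degree F (d : nat) : Prop :=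
  (exists i : 'I_n, tdeg (F 'X_i) = d) /\
  (forall i : 'I_n, (d <= tdeg (F 'X_i))%N).

(* k(F_1, ..., F_n) inside k(x_1, ..., x_n) *)
Definition image_field F : set {fraction {mpoly k[n]}} :=
  generated_subfield
    (range (fun c : k => tofrac (c%:MP_[n])) `|`
     range (fun i : 'I_n => tofrac (F 'X_i))).

Definition jacobian_conjecture : Prop :=
  forall F, invertible_jacobian F -> bijective F.

Definition degree_conjecture : Prop :=
  forall F, invertible_jacobian F ->
  forall d : nat, is_min_degree F d ->
  exists m : nat, ext_degree (image_field F) m /\ (m <= d ^ n.-1)%N.

End Endomorphisms.

Definition infty_jacobian_conjecture (k : fieldType) : Prop :=
  forall n : nat, (1 <= n)%N -> jacobian_conjecture k n.

Definition infty_degree_conjecture (k : fieldType) : Prop :=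
  forall n : nat, (2 <= n)%N -> degree_conjecture k n.

(* Main.v *)
From HB Require Import structures.
Require Import Defs.
From mathcomp Require Import all_boot all_order all_algebra.
From mathcomp Require Import complex reals.
From mathcomp Require Import mpoly boolp classical_sets.
From mathcomp Require Import generic_quotient fraction ring.

(* If F has an invertible Jacobian, so has F x id in one more variable, whose
   minimal degree is 1; the Degree Conjecture then makes F x id birational. So
   the theorem reduces to Keller's birational case: if x_i = p(F) / q(F) then
   x_i is a polynomial in F. A nonconstant q(F) has an irreducible factor rho,
   and I = {g | rho divides g(F)} is a prime ideal containing p and q. Since
   grad g(F) = (h grad rho + rho grad h) J^-1 when g(F) = rho h, gradients of
   elements of I are proportional modulo I; in characteristic 0 this forces I
   to be principal, so p and q have a common factor, which cancels. *)

Set Implicit Arguments.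
Unset Strict Implicit.
Unset Printing Implicit Defensive.

Import GRing.Theory.
Local Open Scope ring_scope.
Local Open Scope quotient_scope.
Local Open Scope classical_set_scope.

(** * Minimal elements, and divisibility in integral domains *)

Lemma exists_argmin (T : Type) (P : T -> Prop) (f : T -> nat) :
  (exists x, P x) -> exists2 x, P x & forall y, P y -> (f x <= f y)%N.
Proof.
move=> [x0 Px0]; pose Q n := `[< exists2 x, P x & f x = n >].
have exQ : exists n, Q n by exists (f x0); apply/asboolP; exists x0.
case: (ex_minnP exQ) => n /asboolP[x Px <-] minx; exists x => // y Py.
by apply: minx; apply/asboolP; exists y.
Qed.

Section Divisibility.
Variable R : idomainType.
Implicit Types a b c p : R.

Definition divides a b : Prop := exists c, b = c * a.

Definition prime_elem p : Prop :=
  [/\ p != 0, p \isn't a GRing.unit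
    & forall a b, divides p (a * b) -> divides p a \/ divides p b].

Definition irreducible_elem p : Prop :=
  [/\ p != 0, p \isn't a GRing.unit
    & forall a b, p = a * b -> a \is a GRing.unit \/ b \is a GRing.unit].

(** Asking for prime rather than irreducible factors makes uniqueness automatic. *)
Definition factorial_domain : Prop :=
  forall a, a != 0 -> exists u (s : seq R),
    [/\ u \is a GRing.unit, forall p, p \in s -> prime_elem p
      & a = u * \prod_(p <- s) p].

Lemma divides_mull p a b : divides p b -> divides p (a * b).
Proof. by move=> [c ->]; exists (a * c); rewrite mulrA. Qed.

Lemma divides_mulr p a b : divides p a -> divides p (a * b).
Proof. by rewrite mulrC; exact: divides_mull. Qed.

Lemma dividesD p a b : divides p a -> divides p b -> divides p (a + b).
Proof. by move=> [c ->] [d ->]; exists (c + d); rewrite mulrDl. Qed.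

Lemma dividesN p a : divides p a -> divides p (- a).
Proof. by move=> [c ->]; exists (- c); rewrite mulNr. Qed.

Lemma dividesB p a b : divides p a -> divides p b -> divides p (a - b).
Proof. by move=> pa pb; apply/dividesD/dividesN. Qed.

Lemma divides_refl p : divides p p.
Proof. by exists 1; rewrite mul1r. Qed.

Lemma divides_trans p a b : divides p a -> divides a b -> divides p b.
Proof. by move=> pa [c ->]; apply: divides_mull. Qed.

Lemma divides_sum p n (F : 'I_n -> R) (P : pred 'I_n) :
  (forall i, P i -> divides p (F i)) -> divides p (\sum_(i < n | P i) F i).
Proof.
move=> pF; elim/big_rec: _ => [|i a Pi pa]; first by exists 0; rewrite mul0r.
by apply: dividesD => //; apply: pF.
Qed.

End Divisibility.

(** Serves, with [can_prime], to pass between polynomials in several variables and polynomials in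
    one of them over the others. *)
Lemma can_irreducible (A B : idomainType) (f : {rmorphism A -> B})
    (g : {rmorphism B -> A}) p :
  cancel f g -> cancel g f -> irreducible_elem p -> irreducible_elem (f p).
Proof.
move=> fK gK [p0 pU pI]; split.
- by rewrite -(rmorph0 f) (can_eq fK).
- by apply: contra pU => /(rmorph_unit g); rewrite fK.
- move=> a b /(congr1 g); rewrite fK rmorphM => /pI[] /(rmorph_unit f).
  + by rewrite gK; left.
  + by rewrite gK; right.
Qed.

Lemma can_prime (A B : idomainType) (f : {rmorphism A -> B})
    (g : {rmorphism B -> A}) p :
  cancel f g -> cancel g f -> prime_elem (f p) -> prime_elem p.
Proof.
move=> fK gK [p0 pU pP].
have divf a : divides (f p) (f a) -> divides p a.
  by move=> [c /(congr1 g)]; rewrite rmorphM !fK; exists (g c).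
split.
- by rewrite -(can_eq fK) rmorph0.
- by apply: contra pU; exact: rmorph_unit.
- move=> a b [c /(congr1 f)]; rewrite !rmorphM => abE.
  by case: (pP (f a) (f b)) => [||]; [exists (f c)|left|right]; auto.
Qed.

(** * Gauss's lemma: primes of R[X] over a factorial domain R *)

Section PrimeInPoly.
Variable R : idomainType.
Implicit Types f g h : {poly R}.

Lemma divides_polyC (c : R) f :
  divides c%:P f <-> forall i, divides c f`_i.
Proof.
split=> [[g ->] i|/choice[g fE]]; first by exists g`_i; rewrite coefMC.
exists (\poly_(i < size f) g i); apply/polyP => i.
by rewrite coefMC coef_poly; case: ltnP => // ?; rewrite mul0r nth_default.
Qed.

(** If [c] divides neither [f] nor [g], let [i] and [j] index their first coefficients not divisible
    by [c]. In the coefficient of [f * g] at [i + j], every term but [f_i g_j] is divisible by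
    [c]. *)
Lemma prime_polyC (c : R) : prime_elem c -> prime_elem c%:P.
Proof.
move=> [c0 cU cP]; split; first by rewrite polyC_eq0.
  by rewrite poly_unitE coefC eqxx negb_and cU orbT.
move=> f g cfg; have [?|/divides_polyC Nf] := EM (divides c%:P f); first by left.
have [?|/divides_polyC Ng] := EM (divides c%:P g); first by right.
exfalso; move/existsNP: Nf => /(exists_argmin id)[i Nfi mini].
move/existsNP: Ng => /(exists_argmin id)[j Ngj minj].
suff /cP[] : divides c (f`_i * g`_j) by [].
have lt_i : (i < (i + j).+1)%N by rewrite ltnS leq_addr.
have -> : f`_i * g`_j = (f * g)`_(i + j) -
    \sum_(k < (i + j).+1 | k != Ordinal lt_i) f`_k * g`_(i + j - k).
  by rewrite coefM (bigD1 (Ordinal lt_i)) //= addKn addrK.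
apply: dividesB; first by move/divides_polyC: cfg; apply.
apply: divides_sum => k; rewrite -val_eqE /= neq_ltn => /orP[lt_ki|lt_ik].
  apply: divides_mulr; apply: contrapT => /mini.
  by rewrite leqNgt lt_ki.
apply: divides_mull; apply: contrapT => /minj.
by rewrite leqNgt ltn_subLR ?ltn_add2r ?lt_ik // -ltnS.
Qed.

Definition is_ideal (A : idomainType) (I : A -> Prop) : Prop :=
  (exists x, I x) /\ forall a b x y, I x -> I y -> I (a * x + b * y).

(** Pseudo-division by a nonzero [h] of least size in [I] leaves a smaller remainder in [I], hence
    zero; [s] is the power of the leading coefficient of [h] that pseudo-division introduces. *)
Lemma ideal_polyC_mul (I : {poly R} -> Prop) : is_ideal I ->
  (exists2 f, I f & f != 0) ->
  exists h, [/\ I h, h != 0 & forall f, I f ->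
    exists2 s : R, s != 0 & divides h (s%:P * f)].
Proof.
move=> [_ idI] [f0 If0 f00]; pose J f := I f /\ f != 0.
have /(exists_argmin (fun f : {poly R} => size f))[h [Ih h0] hmin] : exists f, J f.
  by exists f0.
exists h; split=> // f If; exists (lead_coef h ^+ scalp f h).
  by rewrite expf_neq0 // lead_coef_eq0.
exists (f %/ h); rewrite mul_polyC Pdiv.WeakIdomain.divp_eq.
have [->|r0] := eqVneq (f %% h) 0; first by rewrite addr0.
suff /hmin : J (f %% h).
  by rewrite leqNgt Pdiv.CommonIdomain.ltn_modp h0.
split=> //; have -> : f %% h = (lead_coef h ^+ scalp f h)%:P * f + (- (f %/ h)) * h.
  by rewrite mul_polyC Pdiv.WeakIdomain.divp_eq; ring.
exact: idI.
Qed.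

Hypothesis factR : factorial_domain R.

(** Each prime factor of [s] stays prime in R[X], so it divides [g] or [h] and can be cancelled
    there; [c] and [d] collect what is cancelled. *)
Lemma factor_polyC_mul (s : R) f g h : s != 0 -> s%:P * f = g * h ->
  exists (c d : R) (g' h' : {poly R}),
    [/\ f = g' * h', g = c%:P * g' & h = d%:P * h'].
Proof.
move=> /factR[u [l [uU lP ->]]].
elim: l lP g h => [_|p l IHl lP] g h.
  rewrite big_nil mulr1 => E; exists 1, u, g, (u^-1%:P * h); split.
  - by rewrite mulrCA -E mulrA -polyCM mulVr // mul1r.
  - by rewrite mul1r.
  - by rewrite mulrA -polyCM mulrV // mul1r.
have /prime_polyC[p0 _ pP] : prime_elem p by apply: lP; rewrite mem_head.
rewrite big_cons mulrCA polyCM -mulrA => E.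
have /IHl{}IHl q : q \in l -> prime_elem q by move=> ql; apply: lP; rewrite inE ql orbT.
have /pP[] : divides p%:P (g * h) by rewrite -E mulrC; apply/divides_mull/divides_refl.
- move=> [g1 gE]; move: E; rewrite gE [g1 * _]mulrC -mulrA => E.
  have /IHl[c [d [g' [h' [-> -> ->]]]]] := mulfI p0 E.
  by exists (p * c), d, g', h'; rewrite polyCM -mulrA.
- move=> [h1 hE]; move: E; rewrite hE [h1 * _]mulrC [g * _]mulrCA => E.
  have /IHl[c [d [g' [h' [-> -> ->]]]]] := mulfI p0 E.
  by exists c, (p * d), g', h'; rewrite polyCM -mulrA.
Qed.

(** Cancelling [c] leaves [f] equal to a constant times a divisor of [g]; as [f] is irreducible and
    not constant, that constant is a unit. *)
Lemma irreducible_divides_polyC_mul f g (c : R) : irreducible_elem f ->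
  (1 < size f)%N -> c != 0 -> divides f (c%:P * g) -> divides f g.
Proof.
move=> [f0 fU fI] f1 c0 [h] /(factor_polyC_mul c0)[a [b [h' [f' [-> _ fE]]]]].
have [bU|] := fI _ _ fE.
  by exists (h' * b%:P^-1); rewrite fE -mulrA mulKr.
rewrite poly_unitE => /andP[/eqP szf' _].
by have := size_scale_leq b f'; rewrite szf' leqNgt -mul_polyC -fE f1.
Qed.

(* A nonzero element [h] of minimal degree in the ideal [(f, g)] is, up to
   constants, a gcd of [f] and [g] over the fraction field of [R]; as [f] is
   irreducible, it is up to constants either [f] or [1]. *)
Lemma irreducible_poly_prime f :
  irreducible_elem f -> (1 < size f)%N -> prime_elem f.
Proof.
move=> fI f1; have [f0 fU fIr] := fI; split=> // g g2 fg.
pose I (h : {poly R}) := exists a b : {poly R}, h = a * f + b * g.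
have idI : is_ideal I.
  split=> [|a b _ _ [a1 [b1 ->]] [a2 [b2 ->]]]; first by exists 0, 0, 0; ring.
  by exists (a * a1 + b * a2), (a * b1 + b * b2); ring.
have If : I f by exists 1, 0; ring.
have Ig : I g by exists 0, 1; ring.
have [|h [[a [b hE]] h0 hdiv]] := ideal_polyC_mul idI; first by exists f.
have [s s0 [q sfE]] := hdiv _ If.
have [c [d [q' [h' [fE _ hE']]]]] := factor_polyC_mul s0 sfE.
have d0 : d != 0 by apply: contraNneq h0 => d0; rewrite hE' d0 mul0r.
have [q'U|h'U] := fIr _ _ fE.
  left; have [s2 s20 [q2 E]] := hdiv _ Ig.
  apply: (irreducible_divides_polyC_mul fI f1 s20).
  by exists (q2 * d%:P * q'^-1); rewrite E hE' fE -!mulrA mulKr.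
right; apply: (irreducible_divides_polyC_mul fI f1 d0).
have -> : d%:P * g2 = h'^-1 * (a * g2 * f + b * (g * g2)).
  have -> : a * g2 * f + b * (g * g2) = h * g2 by rewrite hE; ring.
  by rewrite hE' mulrAC mulrCA mulVr ?mulr1.
apply: divides_mull; apply: dividesD; last exact: divides_mull.
exact/divides_mull/divides_refl.
Qed.

End PrimeInPoly.

Lemma mnm_subnn n (m : 'X_{1..n}) : (m - m = 0)%MM.
Proof. by apply/mnmP => i; rewrite mnmBE subnn mnm0E. Qed.

(** * Unique factorization in k[x_1, ..., x_n] *)

Section MpolyFactorial.
Variable k : fieldType.

Lemma mpoly_alg_ind n (P : {mpoly k[n]} -> Prop) :
  (forall c, P c%:MP) -> (forall i, P 'X_i) ->
  (forall p q, P p -> P q -> P (p + q)) ->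
  (forall p q, P p -> P q -> P (p * q)) -> forall p, P p.
Proof.
move=> PC PX PD PM; elim/mpolyind => [|c m p _ _ Pp]; first exact: (PC 0).
apply: PD => //; rewrite -mul_mpolyC; apply: (PM) => //.
rewrite mpolyXE_id; apply: (big_ind P) => [||i _]; [exact: (PC 1)|exact: PM|].
by elim: (m i) => [|e IHe]; [exact: (PC 1)|rewrite exprS; apply: PM].
Qed.

Lemma eq_mpoly_rmorph n (S : pzRingType) (f g : {rmorphism {mpoly k[n]} -> S}) :
  (forall c, f c%:MP = g c%:MP) -> (forall i, f 'X_i = g 'X_i) -> f =1 g.
Proof.
move=> fgC fgX; elim/mpoly_alg_ind => // p q fgp fgq.
- by rewrite !rmorphD fgp fgq.
- by rewrite !rmorphM fgp fgq.
Qed.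

Section SingleOutVariable.
Variables (n : nat) (j : 'I_n.+1).

(** With inverse [mpoly_of_poly], the isomorphism onto polynomials in x_j over the other variables.
    The index [j] is left free because the study of prime ideals chooses it to suit the ideal. *)
Definition poly_of_mpoly : {mpoly k[n.+1]} -> {poly {mpoly k[n]}} :=
  mmap (polyC \o @mpolyC n k)
       (fun i => if unlift j i is Some i' then ('X_i')%:P else 'X).

Definition mpoly_lift : {mpoly k[n]} -> {mpoly k[n.+1]} :=
  mmap (@mpolyC n.+1 k) (fun i => 'X_(lift j i)).

Definition mpoly_of_poly (p : {poly {mpoly k[n]}}) : {mpoly k[n.+1]} :=
  (map_poly mpoly_lift p).['X_j].

HB.instance Definition _ := GRing.RMorphism.on poly_of_mpoly.
HB.instance Definition _ := GRing.RMorphism.on mpoly_lift.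
HB.instance Definition _ := GRing.RMorphism.copy mpoly_of_poly
  (horner_eval 'X_j \o map_poly mpoly_lift).


Lemma mpoly_liftC c : mpoly_lift c%:MP = c%:MP.
Proof. exact: mmapC. Qed.

Lemma mpoly_liftX i : mpoly_lift 'X_i = 'X_(lift j i).
Proof. by rewrite /mpoly_lift mmapX mmap1U. Qed.

Lemma mpoly_of_polyC p : mpoly_of_poly p%:P = mpoly_lift p.
Proof. by rewrite /mpoly_of_poly map_polyC hornerC. Qed.

Lemma mpoly_of_polyX : mpoly_of_poly 'X = 'X_j.
Proof. by rewrite /mpoly_of_poly map_polyX hornerX. Qed.

Lemma poly_of_mpolyC c : poly_of_mpoly c%:MP = c%:MP%:P.
Proof. exact: mmapC. Qed.

Lemma poly_of_mpolyX_lift i : poly_of_mpoly 'X_(lift j i) = ('X_i)%:P.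
Proof. by rewrite /poly_of_mpoly mmapX mmap1U liftK. Qed.

Lemma poly_of_mpolyX : poly_of_mpoly 'X_j = 'X.
Proof. by rewrite /poly_of_mpoly mmapX mmap1U unlift_none. Qed.

Lemma poly_of_mpoly_lift p : poly_of_mpoly (mpoly_lift p) = p%:P.
Proof.
apply: (@eq_mpoly_rmorph _ _ (poly_of_mpoly \o mpoly_lift) polyC) => [c|i] /=.
  by rewrite mpoly_liftC poly_of_mpolyC.
by rewrite mpoly_liftX poly_of_mpolyX_lift.
Qed.

Lemma poly_of_mpolyK : cancel poly_of_mpoly mpoly_of_poly.
Proof.
apply: (@eq_mpoly_rmorph _ _ (mpoly_of_poly \o poly_of_mpoly) idfun) => [c|i] /=.
  by rewrite poly_of_mpolyC mpoly_of_polyC mpoly_liftC.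
case: (unliftP j i) => [i'|] ->.
  by rewrite poly_of_mpolyX_lift mpoly_of_polyC mpoly_liftX.
by rewrite poly_of_mpolyX mpoly_of_polyX.
Qed.

Lemma mpoly_of_polyK : cancel mpoly_of_poly poly_of_mpoly.
Proof.
elim/poly_ind => [|p c IHp]; first by rewrite !rmorph0.
rewrite !rmorphD !rmorphM /= IHp mpoly_of_polyX poly_of_mpolyX.
by rewrite mpoly_of_polyC poly_of_mpoly_lift.
Qed.

Lemma mderiv_lift p : (mpoly_lift p)^`M(j) = 0.
Proof.
elim/mpoly_alg_ind: p => [c|i|p q Dp Dq|p q Dp Dq].
- by rewrite mpoly_liftC mderivC.
- by rewrite mpoly_liftX mderivX mnm1E eq_sym (negPf (neq_lift _ _)) scale0r.
- by rewrite rmorphD mderivD Dp Dq addr0.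
- by rewrite rmorphM mderivM Dp Dq mul0r mulr0 addr0.
Qed.

End SingleOutVariable.

Lemma mpoly_unitE n (p : {mpoly k[n]}) : p \is a GRing.unit = (msize p == 1%N).
Proof.
apply/idP/msize_poly1P => [/andP[/eqP pE]|[c c0 ->]].
  by rewrite unitfE => c0; exists p@_0.
by rewrite rmorph_unit // unitfE.
Qed.

Lemma msize_mul_nonunit n (p q : {mpoly k[n]}) :
  p != 0 -> q != 0 -> p \isn't a GRing.unit -> (msize q < msize (p * q))%N.
Proof.
move=> p0 q0; rewrite mpoly_unitE msizeM // => p1.
have : (0 < msize p)%N by rewrite lt0n msize_poly_eq0.
by case: (msize p) p1 => [|[|m]] //= _ _; rewrite addSn ltnS leq_addl.
Qed.

(** Induction on [msize]: when a nonzero polynomial is a product of two nonunits, both are strictly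
    smaller. *)
Lemma mpoly_factorial_irreducible n :
  (forall p : {mpoly k[n]}, irreducible_elem p -> prime_elem p) ->
  factorial_domain {mpoly k[n]}.
Proof.
move=> irrP p; move: {2}(msize p).+1 (ltnSn (msize p)) => m.
elim: m p => // m IHm p; rewrite ltnS => le_pm p0.
have [pU|pU] := boolP (p \is a GRing.unit).
  by exists p, [::]; rewrite big_nil mulr1.
have [pI|pI] := EM (irreducible_elem p).
  exists 1, [:: p]; rewrite big_seq1 mul1r unitr1; split=> // q.
  by rewrite inE => /eqP->; apply: irrP.
have [a [b [pE aU bU]]] : exists a b, [/\ p = a * b, a \isn't a GRing.unit
    & b \isn't a GRing.unit].
  apply: contrapT => nab; apply: pI; split=> // a b pE.
  have [?|aU] := boolP (a \is a GRing.unit); first by left.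
  have [?|bU] := boolP (b \is a GRing.unit); first by right.
  by case: nab; exists a, b.
have a0 : a != 0 by apply: contraNneq p0 => a0; rewrite pE a0 mul0r.
have b0 : b != 0 by apply: contraNneq p0 => b0; rewrite pE b0 mulr0.
have [||u [s [uU sP aE]]] := IHm a => //.
  by apply: leq_trans le_pm; rewrite pE mulrC msize_mul_nonunit.
have [||v [t [vU tP bE]]] := IHm b => //.
  by apply: leq_trans le_pm; rewrite pE msize_mul_nonunit.
exists (u * v), (s ++ t); split.
- by rewrite unitrM uU vU.
- by move=> q; rewrite mem_cat => /orP[/sP|/tP].
- by rewrite big_cat pE aE bE mulrACA.
Qed.

(** Induction on the number of variables. In R[X], with R factorial by induction, an irreducible of
    positive degree is prime by Gauss's lemma, and a constant one because it is prime in R. *)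
Lemma mpoly_irreducible_prime n (p : {mpoly k[n]}) :
  irreducible_elem p -> prime_elem p.
Proof.
elim: n p => [|n IHn] p pI.
  (* Without variables every polynomial is a constant, so a nonzero one is a unit. *)
  have [p0 pU _] := pI; case/negP: pU; rewrite mpoly_unitE; apply/msize_poly1P.
  have pE : p = (p@_0)%:MP.
    apply/mpolyP => m; rewrite mcoeffC (_ : m = 0%MM) ?eqxx ?mulr1 //.
    by apply/mnmP => -[].
  by exists p@_0 => //; rewrite -(mpolyC_eq0 0) -pE.
have fK := @poly_of_mpolyK n ord0; have gK := @mpoly_of_polyK n ord0.
apply: (can_prime fK gK); 
  have fI : irreducible_elem (poly_of_mpoly ord0 p) := can_irreducible fK gK pI.
have [le1|gt1] := leqP (size (poly_of_mpoly ord0 p)) 1; last first.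
  exact: (irreducible_poly_prime (mpoly_factorial_irreducible IHn) fI gt1).
have pE := size1_polyC le1; move: fI; rewrite /= pE.
set c := _`_0 => -[c0 cU cI]; apply/prime_polyC/IHn; split.
- by rewrite -polyC_eq0.
- by move: cU; rewrite poly_unitE coefC eqxx size_polyC -polyC_eq0 c0.
- move=> a b cE; have := cI a%:P b%:P; rewrite -polyCM cE => /(_ erefl).
  by rewrite !poly_unitE !coefC !eqxx; case=> /andP[]; [left|right].
Qed.

Lemma mpoly_irreducible_factor n (p : {mpoly k[n]}) :
  p != 0 -> p \isn't a GRing.unit -> exists2 q, prime_elem q & divides q p.
Proof.
move=> p0 pU; have := mpoly_factorial_irreducible (@mpoly_irreducible_prime n) p0.
move=> [u [[|q s] [uU sP pE]]].
  by case/negP: pU; rewrite pE big_nil mulr1.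
exists q; first by apply: sP; rewrite mem_head.
by exists (u * \prod_(r <- s) r); rewrite pE big_cons mulrAC -mulrA mulrCA mulrA.
Qed.

End MpolyFactorial.

(** * Prime ideals with proportional gradients are principal *)

Lemma msize_mderiv (k : fieldType) n (p : {mpoly k[n]}) i :
  p^`M(i) != 0 -> (msize p^`M(i) < msize p)%N.
Proof.
move=> q0; rewrite -(mlead_deg q0); set m := mlead _.
have : (p^`M(i))@_m != 0 by rewrite mleadc_eq0.
rewrite mcoeff_mderiv => pm; have /msize_mdeg_lt : (m + U_(i))%MM \in msupp p.
  by rewrite mcoeff_msupp; apply: contraNneq pm => ->; rewrite mul0rn.
by rewrite mdegD mdeg1 addn1.
Qed.

Section PrimeIdeals.
Variables (k : fieldType) (n : nat).
Hypothesis char0 : [pchar k] =i pred0.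

(** The coefficient of [m] in [p], times [m i], is a coefficient of the [i]-th derivative; in
    characteristic 0 a nonzero exponent [m i] can be cancelled. *)
Lemma mderiv_eq0 (p : {mpoly k[n]}) :
  (forall i, p^`M(i) = 0) -> p = (p@_0)%:MP.
Proof.
move=> Dp; apply/mpolyP => m; rewrite mcoeffC.
have [->|m0] := eqVneq m 0%MM; first by rewrite mulr1.
have [i mi] : exists i, m i != 0%N.
  apply: contrapT => nm; case/eqP: m0; apply/mnmP => i; rewrite mnm0E.
  by apply/eqP; apply: contrapT => mi; apply: nm; exists i; apply/negP.
have mE : m = (m - U_(i) + U_(i))%MM.
  rewrite submK //; apply/mnm_lepP => l; rewrite mnm1E.
  by case: eqP => // <-; rewrite lt0n.
have := congr1 (mcoeff (m - U_(i))%MM) (Dp i).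
rewrite mcoeff_mderiv -mE mcoeff0 => /eqP; rewrite -[_ *+ _]mulr_natr.
by rewrite mulf_eq0 ((pcharf0P k).1 char0) orbF !mulr0 => /eqP.
Qed.

Variable I : {mpoly k[n]} -> Prop.
Hypothesis idI : is_ideal I.
Hypothesis I1 : ~ I 1.
Hypothesis primeI : forall p q, I (p * q) -> I p \/ I q.
Hypothesis minorI : forall p q, I p -> I q ->
  forall i j, I (p^`M(i) * q^`M(j) - p^`M(j) * q^`M(i)).

Lemma ideal_mull p q : I q -> I (p * q).
Proof. by move=> Iq; have := idI.2 p 0 _ _ Iq Iq; rewrite mul0r addr0. Qed.

Lemma ideal_const c : I c%:MP -> c = 0.
Proof.
move=> Ic; apply/eqP; apply: contrapT => /negP c0; apply: I1.
by have := ideal_mull c^-1%:MP Ic; rewrite -mpolyCM mulVf.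
Qed.

(* Minors with [r] show that the elements of [I] not involving [x_j] are stable
   under all derivations; a nonzero one would yield a nonzero constant. *)
Lemma ideal_mderiv0 r j s : I r -> ~ I r^`M(j) -> I s -> s^`M(j) = 0 -> s = 0.
Proof.
move=> Ir Irj; move: {2}(msize s).+1 (ltnSn (msize s)) => m.
elim: m s => // m IHm s; rewrite ltnS => le_sm Is sj.
have Ds i : s^`M(i) = 0.
  apply/eqP; apply: contrapT => /negP si0; case/eqP: (si0); apply: IHm.
  - exact: leq_trans (msize_mderiv si0) le_sm.
  - have := minorI Is Ir i j; rewrite sj mul0r subr0 => /primeI[] //.
  - by rewrite mderiv_comm sj mderiv0.
have sE := mderiv_eq0 Ds; rewrite sE; rewrite sE in Is.
by rewrite (ideal_const Is) mpolyC0.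
Qed.

End PrimeIdeals.

(** A nonzero [r] of least size in [I] is prime, so it divides [p] once it divides some [s * p] with
    [s] outside [I]. Such multiples are found by viewing [I] in one variable x_j, where a single
    element generates it up to factors free of x_j. *)
Lemma prime_ideal_principal (k : fieldType) n (I : {mpoly k[n]} -> Prop) :
  [pchar k] =i pred0 -> is_ideal I -> ~ I 1 ->
  (forall p q, I (p * q) -> I p \/ I q) ->
  (forall p q, I p -> I q ->
     forall i j, I (p^`M(i) * q^`M(j) - p^`M(j) * q^`M(i))) ->
  (exists2 p, I p & p != 0) ->
  exists2 r, I r & forall p, I p -> divides r p.
Proof.
move=> char0 idI I1 primeI minorI [p0 Ip0 p00].
have mullI := ideal_mull idI.
pose J p := I p /\ p != 0.
have /(exists_argmin (fun p : {mpoly k[n]} => msize p))[r [Ir r0] rmin] : exists p, J p.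
  by exists p0.
have rprime : prime_elem r.
  apply: mpoly_irreducible_prime; split=> //.
    by apply/negP => rU; apply: I1; rewrite -(mulVr rU); apply: mullI.
  (* A factor lying in [I] is at least as large as [r], so its cofactor is a unit. *)
  have aux a b : r = a * b -> I a -> b \is a GRing.unit.
    move=> rE Ia; have a0 : a != 0 by apply: contraNneq r0 => a0; rewrite rE a0 mul0r.
    have b0 : b != 0 by apply: contraNneq r0 => b0; rewrite rE b0 mulr0.
    apply: contraT => /(msize_mul_nonunit b0 a0); rewrite mulrC -rE ltnNge.
    by rewrite rmin.
  move=> a b rE; have := Ir; rewrite rE => /primeI[Ia|Ib].
    by right; apply: aux rE Ia.
  by left; apply: aux Ib; rewrite mulrC.
(* If all derivatives of [r] were in [I], minimality would make them vanish, and [r] would be a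
   constant in [I], hence zero. *)
have [j rj] : exists j, ~ I r^`M(j).
  apply/existsNP => Dr; suff rE : r = (r@_0)%:MP.
    move: r0; rewrite rE; rewrite rE in Ir.
    by rewrite (ideal_const idI I1 Ir) mpolyC0 eqxx.
  apply: (mderiv_eq0 char0) => i; apply/eqP; apply: contrapT => /negP ri0.
  have /rmin : J r^`M(i) by split.
  by rewrite leqNgt msize_mderiv.
(* The index [j] rules out [n = 0], so x_j can be singled out. *)
case: n j => [[]//|n] j in I idI I1 primeI minorI p0 Ip0 p00 mullI J r Ir r0 rmin rprime rj *.
have no_free s : s != 0 -> ~ I (mpoly_lift j s).
  move=> s0 Is.
  have := ideal_mderiv0 char0 idI I1 primeI minorI Ir rj Is (mderiv_lift j s).
  move/(congr1 (poly_of_mpoly j)); rewrite poly_of_mpoly_lift rmorph0 => /eqP.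
  by rewrite polyC_eq0 (negPf s0).
pose Ij p := I (mpoly_of_poly j p).
have idIj : is_ideal Ij.
  split=> [|a b x y Ix Iy].
    by exists (poly_of_mpoly j r); rewrite /Ij poly_of_mpolyK.
  by rewrite /Ij rmorphD !rmorphM; apply: idI.2.
have [|h [Ih h0 hdiv]] := ideal_polyC_mul idIj.
  exists (poly_of_mpoly j r); first by rewrite /Ij poly_of_mpolyK.
  by rewrite -(rmorph0 (poly_of_mpoly j)) (can_eq (poly_of_mpolyK j)).
pose g := mpoly_of_poly j h.
have gdiv p : I p -> exists2 s, s != 0 & divides g (mpoly_lift j s * p).
  move=> Ip; case: (hdiv (poly_of_mpoly j p)) => [|s s0 [q E]].
    by rewrite /Ij poly_of_mpolyK.
  exists s => //; exists (mpoly_of_poly j q).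
  by rewrite -mpoly_of_polyC -[p in LHS](poly_of_mpolyK j) -!rmorphM E.
have [_ _ rP] := rprime.
have rg : divides r g.
  have [s s0 [q E]] := gdiv _ Ir.
  (* If [r] divided [q] in [s * r = q * g], cancelling [r] would put the nonzero [s], free of x_j,
     in [I]. *)
  have /rP[[q' qE]|//] : divides r (q * g) by rewrite -E; apply/divides_mull/divides_refl.
  case: (no_free s s0); suff -> : mpoly_lift j s = q' * g by apply: mullI.
  by apply: (mulIf r0); rewrite E qE; ring.
exists r => // p /gdiv[s s0 /(divides_trans rg)/rP[[q sE]|//]].
by case: (no_free s s0); rewrite sE; apply: mullI.
Qed.

(** * Keller's theorem in the birational case *)

Section Keller.
Variables (k : fieldType) (n : nat).
Hypothesis char0 : [pchar k] =i pred0.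
Variable F : {lrmorphism {mpoly k[n]} -> {mpoly k[n]}}.

Lemma lrmorph_mpolyC c : F c%:MP = c%:MP.
Proof. by rewrite -[c%:MP]mulr1 mul_mpolyC linearZ /= rmorph1 -mul_mpolyC mulr1. Qed.

(** The chain rule: both sides agree on constants and variables and obey the same sum and product
    rules. *)
Lemma mderiv_lrmorph p j :
  (F p)^`M(j) = \sum_i F p^`M(i) * (F 'X_i)^`M(j).
Proof.
elim/mpoly_alg_ind: p => [c|l|p q Dp Dq|p q Dp Dq].
- rewrite lrmorph_mpolyC mderivC big1 // => i _.
  by rewrite mderivC rmorph0 mul0r.
- rewrite (bigD1 l) //= big1 => [|i il]; rewrite mderivX mnm1E.
    by rewrite eqxx mnm_subnn scale1r mpolyX0 rmorph1 mul1r addr0.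
  by rewrite eq_sym (negPf il) scale0r rmorph0 mul0r.
- rewrite rmorphD mderivD Dp Dq -big_split; apply: eq_bigr => i _.
  by rewrite mderivD rmorphD mulrDl.
- rewrite rmorphM mderivM Dp Dq mulr_suml mulr_sumr -big_split.
  by apply: eq_bigr => i _; rewrite mderivM rmorphD !rmorphM /=; ring.
Qed.

Lemma jacobian_gradient p :
  (\row_i F p^`M(i)) *m jacobian_matrix F = \row_j (F p)^`M(j).
Proof.
apply/rowP => j; rewrite !mxE mderiv_lrmorph.
by apply: eq_bigr => i _; rewrite !mxE.
Qed.

Hypothesis jacF : invertible_jacobian F.

Lemma jacobian_unit : jacobian_matrix F \in unitmx.
Proof.
have [c [c0 E]] := jacF; rewrite unitmxE E mpoly_unitE.
by apply/msize_poly1P; exists c.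
Qed.

Lemma gradient_jacobian p :
  \row_i F p^`M(i) = (\row_j (F p)^`M(j)) *m invmx (jacobian_matrix F).
Proof. by rewrite -jacobian_gradient mulmxK ?jacobian_unit. Qed.

(** If [F p = 0], then [F p] has zero gradient, and inverting the Jacobian matrix shows that [F]
    kills every derivative of [p]. By induction on size these vanish, so [p] is a constant, which
    [F] fixes. *)
Lemma invertible_jacobian_inj : injective F.
Proof.
suff F0 p : F p = 0 -> p = 0.
  by move=> p q pq; apply/subr0_eq/F0; rewrite rmorphB /= pq subrr.
move: {2}(msize p).+1 (ltnSn (msize p)) => m.
elim: m p => // m IHm p; rewrite ltnS => le_pm Fp.
have Dp i : p^`M(i) = 0.
  apply/eqP; apply: contrapT => /negP pi0; case/eqP: (pi0); apply: IHm.
    exact: leq_trans (msize_mderiv pi0) le_pm.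
  have /rowP/(_ i) := gradient_jacobian p.
  rewrite (_ : \row_j (F p)^`M(j) = 0) ?mul0mx ?mxE //.
  by apply/rowP => j; rewrite !mxE Fp mderiv0.
have pE := mderiv_eq0 char0 Dp.
by move: Fp; rewrite pE lrmorph_mpolyC => ->.
Qed.

(** If [F 'X_i] were constant, it would also be the image of that constant, against injectivity. *)
Lemma tdeg_invertible_jacobian i : (0 < tdeg (F 'X_i))%N.
Proof.
rewrite /tdeg -subn1 subn_gt0 ltnNge; apply/negP => le1.
have /invertible_jacobian_inj XC : F 'X_i = F ((F 'X_i)@_0)%:MP.
  by rewrite lrmorph_mpolyC; apply: msize1_polyC.
by have := congr1 (fun p => msize p) XC; rewrite msizeX mdeg1 msizeC; case: (_ != 0).
Qed.

(* Modulo [rho], the gradient of [p] evaluated at [F] is the quotient of [F p]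
   by [rho] times a row that does not depend on [p]. *)
Lemma divides_gradient_minor rho p q i j :
  divides rho (F p) -> divides rho (F q) ->
  divides rho (F (p^`M(i) * q^`M(j) - p^`M(j) * q^`M(i))).
Proof.
pose K := invmx (jacobian_matrix F).
pose v := (\row_l rho^`M(l)) *m K.
have aux s : divides rho (F s) ->
    exists (h : {mpoly k[n]}) (w : 'rV[{mpoly k[n]}]_n),
      forall l, F s^`M(l) = h * v 0 l + rho * w 0 l.
  move=> [h sE]; exists h, ((\row_l h^`M(l)) *m K) => l.
  have /rowP/(_ l) := gradient_jacobian s; rewrite mxE => ->.
  rewrite !mxE !mulr_sumr -big_split; apply: eq_bigr => a _.
  by rewrite !mxE sE mderivM /=; ring.
move=> /aux[h [w pE]] /aux[h' [w' qE]].
rewrite rmorphB !rmorphM /= !pE !qE.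
exists ((h * v 0 i + rho * w 0 i) * w' 0 j + w 0 i * h' * v 0 j
  - (h * v 0 j + rho * w 0 j) * w' 0 i - w 0 j * h' * v 0 i).
by ring.
Qed.

(** Induction on the size of the denominator [q]: as long as [F q] is not a unit, [p] and [q] share
    a nonunit factor [r] to cancel. *)
Lemma fraction_in_image p q b : q != 0 -> F q * b = F p -> exists a, b = F a.
Proof.
move: {2}(msize q).+1 (ltnSn (msize q)) => m.
elim: m p q => // m IHm p q; rewrite ltnS => le_qm q0 E.
have Fq0 : F q != 0 by rewrite -(rmorph0 F) (inj_eq invertible_jacobian_inj).
have [Uq|nUq] := boolP (F q \is a GRing.unit).
  move: (Uq); rewrite mpoly_unitE => /msize_poly1P[c c0 FqE].
  exists (c^-1%:MP * p); rewrite rmorphM /= -E FqE lrmorph_mpolyC mulrA.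
  by rewrite -mpolyCM mulVf // mul1r.
have [rho [rho0 rhoU rhoP] [h FqE]] := mpoly_irreducible_factor Fq0 nUq.
pose I s := divides rho (F s).
have Iq : I q by exists h.
have [|||||r Ir rdiv] := prime_ideal_principal (I := I) char0.
- split=> [|a c x y Ix Iy]; first by exists q.
  by rewrite /I rmorphD !rmorphM /=; apply: dividesD; apply: divides_mull.
- move=> [c]; rewrite rmorph1 => E1; case/negP: rhoU.
  by apply/unitrPr; exists c; rewrite mulrC.
- by move=> s t; rewrite /I rmorphM; apply: rhoP.
- by move=> s t Is It i j; apply: divides_gradient_minor.
- by exists q.
have [q' qE] := rdiv _ Iq.
have [|p' pE] := rdiv p; first by rewrite /I -E; apply: divides_mulr.
have q'0 : q' != 0 by apply: contraNneq q0 => q'0; rewrite qE q'0 mul0r.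
have r0 : r != 0 by apply: contraNneq q0 => r0; rewrite qE r0 mulr0.
(* [F r] is a multiple of [rho], so if [r] were a unit, [rho] would be one too. *)
have rU : r \isn't a GRing.unit.
  apply: contra rhoU => /(rmorph_unit F) FrU; have [c rE] := Ir.
  by move: FrU; rewrite /= rE unitrM => /andP[].
apply: (IHm p' q') => //.
  by apply: leq_trans le_qm; rewrite qE mulrC msize_mul_nonunit.
have Fr0 : F r != 0 by rewrite -(rmorph0 F) (inj_eq invertible_jacobian_inj).
have FME a c : F (a * c) = F a * F c by exact: rmorphM.
by apply: (mulIf Fr0); rewrite -FME -pE -E qE FME mulrAC.
Qed.

End Keller.

(** * Fractions and the subfield k(F_1, ..., F_n) *)

Lemma fraction_tofrac (R : idomainType) (z : {fraction R}) :
  exists p q : R, z = tofrac p / tofrac q.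
Proof.
elim/quotW: z => x; exists (frac x).1, (frac x).2; unlock FracField.tofrac.
rewrite -[RHS]/(FracField.mul _ (FracField.inv _)) -FracField.pi_inv -FracField.pi_mul.
apply/eqmodP; rewrite /= FracField.equivfE /FracField.mulf /FracField.invf.
by rewrite !numden_Ratio ?oner_neq0 ?mul1r ?mulr1 ?denom_ratioP // mulrC.
Qed.

Section ImageField.
Variables (k : fieldType) (n : nat).
Variable F : {lrmorphism {mpoly k[n]} -> {mpoly k[n]}}.

Lemma generated_subfield_closed (L : fieldType) (G : set L) :
  let K := generated_subfield G in
  [/\ K 1, forall x y, K x -> K y -> K (x - y) & forall x y, K x -> K y -> K (x / y)].
Proof.
split=> [S [[S1 _ _] _]|x y xS yS S SP|x y xS yS S SP].
- exact: set_mem S1.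
- have [[_ SB _] _] := SP; apply: set_mem; apply: SB; apply: mem_set.
    exact: xS.
  exact: yS.
- have [[_ _ SD] _] := SP; apply: set_mem; apply: SD; apply: mem_set.
    exact: xS.
  exact: yS.
Qed.

(** Fractions of elements of the image of [F] form a subfield containing the generators, and
    [image_field F] is the smallest such. Injectivity keeps the denominators nonzero. *)
Lemma image_field_fraction : injective F ->
  forall z : {fraction {mpoly k[n]}}, image_field F z ->
  exists p q : {mpoly k[n]}, q != 0 /\ z * tofrac (F q) = tofrac (F p).
Proof.
move=> injF z; pose S : set {fraction {mpoly k[n]}} :=
  [set z : {fraction {mpoly k[n]}} | exists p q : {mpoly k[n]},
    q != 0 /\ z * tofrac (F q) = tofrac (F p)].
have F0 q : q != 0 -> tofrac (F q) != 0.
  by move=> q0; rewrite tofrac_eq0 -(rmorph0 F) (inj_eq injF).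
move/(_ S); apply; split; last first.
  move=> _ [[c _ <-]|[i _ <-]].
    exists c%:MP, 1; split; first exact: oner_neq0.
    by rewrite rmorph1 tofrac1 mulr1 lrmorph_mpolyC.
  by exists 'X_i, 1; rewrite oner_neq0 rmorph1 tofrac1 mulr1.
split=> [|x y|x y].
- by apply: mem_set; exists 1, 1; rewrite oner_neq0 mul1r.
- move=> /set_mem[p [q [q0 xE]]] /set_mem[p' [q' [q'0 yE]]].
  apply: mem_set; exists (p * q' - p' * q), (q * q'); split; first by rewrite mulf_neq0.
  rewrite !(rmorphB, rmorphM) /= mulrBl -xE -yE; congr (_ - _).
    by rewrite mulrA.
  by rewrite mulrCA mulrC.
- move=> /set_mem[p [q [q0 xE]]] /set_mem[p' [q' [q'0 yE]]].
  (* Division by zero returns 0, which is the fraction 0 / 1. *)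
  have [->|y0] := eqVneq y 0.
    by apply: mem_set; exists 0, 1; rewrite oner_neq0 invr0 mulr0 mul0r rmorph0 tofrac0.
  apply: mem_set; exists (p * q'), (q * p'); split.
    rewrite mulf_neq0 //; apply: contraNneq y0 => p'0.
    by move/eqP: yE; rewrite p'0 rmorph0 tofrac0 mulf_eq0 (negPf (F0 _ q'0)) orbF.
  rewrite !rmorphM /= -xE -yE [tofrac _ * (y * _)]mulrCA.
  by rewrite [LHS]mulrA mulfVK // mulrA.
Qed.

Lemma image_field_tofrac p : image_field F (tofrac (F p)).
Proof.
rewrite /image_field; set G := (X in generated_subfield X).
have [K1 KB KD] := generated_subfield_closed G.
have subG x : G x -> generated_subfield G x by apply: sub_gen_smallest.
have K0 : generated_subfield G 0 by rewrite -(subrr 1); apply: KB.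
have KV x : generated_subfield G x -> generated_subfield G x^-1.
  by rewrite -[x^-1]mul1r; apply: KD.
elim/mpoly_alg_ind: p => [c|i|p q Kp Kq|p q Kp Kq].
- by rewrite lrmorph_mpolyC; apply: subG; left; exists c.
- by apply: subG; right; exists i.
(* Closure is given for differences and quotients only: a sum is written x - (0 - y), and a product
   x / y^-1. *)
- rewrite rmorphD tofracD -[tofrac (F q)]opprK -[- tofrac _]sub0r.
  by apply: (KB) => //; apply: KB.
- rewrite rmorphM tofracM -[tofrac (F q)]invrK.
  by apply: (KD) => //; apply: KV.
Qed.

Lemma image_field_surj : (forall p, exists q, p = F q) -> 
  forall z : {fraction {mpoly k[n]}}, image_field F z.
Proof.
move=> surjF z; have [_ _ KD] := generated_subfield_closed
  (range (fun c : k => tofrac (c%:MP_[n])) `|` range (fun i : 'I_n => tofrac (F 'X_i))).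
have [p [q ->]] := fraction_tofrac z.
have [p' ->] := surjF p; have [q' ->] := surjF q.
by apply: KD; apply: image_field_tofrac.
Qed.

End ImageField.

(** * Adding a variable: the endomorphism F x id *)

Lemma mderiv_lift_lift (k : fieldType) n (j : 'I_n.+1) (p : {mpoly k[n]}) i :
  (mpoly_lift j p)^`M(lift j i) = mpoly_lift j p^`M(i).
Proof.
elim/mpoly_alg_ind: p => [c|l|p q Dp Dq|p q Dp Dq].
- by rewrite mpoly_liftC !mderivC rmorph0.
- rewrite mpoly_liftX !mderivX !mnm1E (inj_eq lift_inj).
  have [->|_] := eqVneq l i; last by rewrite !scale0r rmorph0.
  by rewrite !mnm_subnn !scale1r !mpolyX0 rmorph1.
- by rewrite mderivD !rmorphD /= mderivD Dp Dq.
- by rewrite mderivM rmorphD !rmorphM /= mderivM Dp Dq.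
Qed.

Section Stabilization.
Variables (k : fieldType) (n : nat).
Variable F : {lrmorphism {mpoly k[n]} -> {mpoly k[n]}}.

(** This is F x id. The added variable, at index [ord0], is fixed, so one component has degree 1,
    which brings the degree bound down to 1. *)
Definition stabilization : {lrmorphism {mpoly k[n.+1]} -> {mpoly k[n.+1]}} :=
  comp_mpoly [tuple if unlift ord0 i is Some i' then mpoly_lift ord0 (F 'X_i')
                    else 'X_ord0 | i < n.+1].

Lemma stabilization_X0 : stabilization 'X_ord0 = 'X_ord0.
Proof. by rewrite /= comp_mpolyXU -tnth_nth tnth_mktuple unlift_none. Qed.

Lemma stabilization_lift i :
  stabilization 'X_(lift ord0 i) = mpoly_lift ord0 (F 'X_i).
Proof. by rewrite /= comp_mpolyXU -tnth_nth tnth_mktuple liftK. Qed.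

(** The first row of the Jacobian matrix is (1, 0, ..., 0); expanding along it leaves the lifted
    Jacobian determinant of [F]. *)
Lemma invertible_jacobian_stabilization :
  invertible_jacobian F -> invertible_jacobian stabilization.
Proof.
move=> [c [c0 detF]]; exists c; split=> //.
rewrite (expand_det_row _ ord0) big_ord_recl big1 => [|i _]; rewrite mxE stabilization_X0.
  rewrite mderivX mnm1E eqxx scale1r addr0.
  rewrite mnm_subnn mpolyX0 mul1r /cofactor expr0 mul1r.
  rewrite -[RHS](mpoly_liftC ord0 c) -detF -det_map_mx; congr (\det _).
  by apply/matrixP => a b; rewrite !mxE stabilization_lift mderiv_lift_lift.
by rewrite mderivX mnm1E scale0r mul0r.
Qed.

(** Setting the added variable to 0 intertwines [stabilization] with [F], so it sends a preimage of
    the lift of [p] to a preimage of [p]. *)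
Lemma stabilization_surj :
  (forall p, exists q, p = stabilization q) -> forall p, exists q, p = F q.
Proof.
move: stabilization_X0 stabilization_lift; move: stabilization => G GX0 GX surjG.
have [drop [dropC dropX0 dropX]] :
    exists drop : {rmorphism {mpoly k[n.+1]} -> {mpoly k[n]}},
    [/\ forall c, drop c%:MP = c%:MP, drop 'X_ord0 = 0
      & forall i, drop 'X_(lift ord0 i) = 'X_i].
  exists (mmap (@mpolyC n k) (fun i => if unlift ord0 i is Some i' then 'X_i' else 0)).
  split=> [c||i] /=; first exact: mmapC.
    by rewrite mmapX mmap1U unlift_none.
  by rewrite mmapX mmap1U liftK.
have dropK p : drop (mpoly_lift ord0 p) = p.
  apply: (@eq_mpoly_rmorph _ _ _ (drop \o mpoly_lift ord0) idfun) => [c|i] /=.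
    by rewrite mpoly_liftC dropC.
  by rewrite mpoly_liftX dropX.
have dropG p : drop (G p) = F (drop p).
  apply: (@eq_mpoly_rmorph _ _ _ (drop \o G) (F \o drop)) => [c|i] /=.
    by rewrite lrmorph_mpolyC !dropC lrmorph_mpolyC.
  case: (unliftP ord0 i) => [i'|] ->; first by rewrite GX dropX dropK.
  by rewrite GX0 dropX0 rmorph0.
move=> p; have [q E] := surjG (mpoly_lift ord0 p).
by exists (drop q); rewrite -dropG -E dropK.
Qed.

End Stabilization.

(** * The two implications *)

Lemma lrmorph_surj (k : fieldType) n (F : {lrmorphism {mpoly k[n]} -> {mpoly k[n]}}) :
  (forall i, exists q, 'X_i = F q) -> forall p, exists q, p = F q.
Proof.
move=> FX; elim/mpoly_alg_ind => [c||_ _ [p ->] [q ->]|_ _ [p ->] [q ->]] //.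
- by exists c%:MP; rewrite lrmorph_mpolyC.
- by exists (p + q); rewrite rmorphD.
- by exists (p * q); rewrite rmorphM.
Qed.

(** Degree 0 is impossible, since 1 is not an empty sum. In degree 1 the basis vector is the inverse
    of an element of [K], so its multiples by [K] stay in [K]. *)
Lemma ext_degree_le1 (L : fieldType) (K : set L) m :
  (forall x y, K x -> K y -> K (x / y)) -> ext_degree K m -> (m <= 1)%N ->
  forall z, K z.
Proof.
move=> KD [b [_ span]]; case: m b span => [|[|//]] b span _ z.
  by have [a [_ /eqP]] := span 1; rewrite big_ord0 oner_eq0.
have [a [Ka aE]] := span 1; have [c [Kc ->]] := span z.
move: aE; rewrite !big_ord1 => aE.
have b0 : b ord0 != 0.
  by apply/eqP => b0; move/eqP: aE; rewrite b0 mulr0 oner_eq0.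
have a0 : a ord0 != 0.
  by apply/eqP => a0; move/eqP: aE; rewrite a0 mul0r oner_eq0.
have -> : b ord0 = (a ord0)^-1 by apply: (mulfI a0); rewrite -aE mulfV.
exact: KD.
Qed.

Lemma jacobian_of_degree_conjecture (k : fieldType) n : [pchar k] =i pred0 ->
  degree_conjecture k n.+1 -> jacobian_conjecture k n.
Proof.
move=> char0 degC F jacF; set G := stabilization F.
have jacG : invertible_jacobian G by apply: invertible_jacobian_stabilization.
(* The minimal degree 1 is attained at the added variable, as no component of [G] is constant. *)
have [|m [deg_m]] := degC G jacG 1%N.
  split=> [|i]; last exact: tdeg_invertible_jacobian.
  by exists ord0; rewrite /tdeg stabilization_X0 msizeX mdeg1.
rewrite exp1n => le_m1.
have [_ _ KD] := generated_subfield_closed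
  (range (fun c : k => tofrac (c%:MP_[n.+1])) `|`
   range (fun i : 'I_n.+1 => tofrac (G 'X_i))).
have injG := invertible_jacobian_inj char0 jacG.
have surjF : forall p, exists q, p = F q.
  apply: stabilization_surj; apply: lrmorph_surj => i.
  (* Degree at most 1 puts the variable in [image_field G]; clearing the denominator gives
     [G q * 'X_i = G p], as [fraction_in_image] requires. *)
  have [p [q [q0]]] := image_field_fraction injG
    (ext_degree_le1 KD deg_m le_m1 (tofrac 'X_i)).
  rewrite -tofracM => /eqP; rewrite tofrac_eq => /eqP; rewrite mulrC.
  move=> E; exact: (fraction_in_image char0 jacG q0 E).
have [g gE] := choice surjF.
exists g => p; last by rewrite -gE.
by apply: (invertible_jacobian_inj char0 jacF); rewrite -gE.
Qed.

(** For an automorphism k(F) is all of k(x), so the degree is 1 with basis 1; the bound is at least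
    1 because no component is constant. *)
Lemma degree_of_jacobian_conjecture (k : fieldType) n : [pchar k] =i pred0 ->
  jacobian_conjecture k n -> degree_conjecture k n.
Proof.
move=> char0 JC F jacF d [[i <-] _]; have [g _ gK] := JC F jacF.
exists 1%N; split; last by rewrite expn_gt0 tdeg_invertible_jacobian.
exists (fun=> 1); split=> [a _|z].
  by rewrite big_ord1 mulr1 => a0 i'; rewrite ord1.
exists (fun=> z); rewrite big_ord1 mulr1; split=> // _.
by apply: image_field_surj => p; exists (g p); rewrite gK.
Qed.

Theorem theorem3p7 (R : realType) :
  infty_degree_conjecture (R[i])%C <-> infty_jacobian_conjecture (R[i])%C.
Proof.
have char0 : [pchar (R[i])%C] =i pred0 by exact: Num.Theory.pchar_num.
(* The Jacobian statement in [n] variables comes from the degree statement in [n.+1], and [1 <= n]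
   gives [2 <= n.+1]. *)
split=> H n n_gt; first exact/jacobian_of_degree_conjecture/H.
by apply/degree_of_jacobian_conjecture/H => //; apply: ltnW.
Qed.
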